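(* Let $n,d\ge 1$, let $A=(a_{kj})$ be a real $n\times n$ matrix, and let $B(\vec{x},\vec{y})=\sum_{k,j=1}^n a_{kj}\,\vec{x}_k\cdot\vec{y}_j$ for $\vec{x}=(\vec{x}_1,\dots,\vec{x}_n)$, $\vec{y}=(\vec{y}_1,\dots,\vec{y}_n)\in(\mathbb{R}^d)^n$. Let $(\vec{x},\vec{y})$ be an optimal point of $B$ under the constraint $|\vec{x}_k|=|\vec{y}_k|=1$ for $1\le k\le n$. Let $\lambda_k,\mu_k$ be the associated Lagrange multipliers, i.e. $\lambda_k=\sum_{j=1}^n a_{kj}\,\vec{x}_k\cdot\vec{y}_j$ and $\mu_k=\sum_{j=1}^n a_{jk}\,\vec{x}_j\cdot\vec{y}_k$ for $1\le k\le n$, and put $\Lambda=\mathrm{diag}(\lambda_1,\dots,\lambda_n)$, $M=\mathrm{diag}(\mu_1,\dots,\mu_n)$. Assume that all $\lambda_k$ and all $\mu_k$ are nonzero. Then $$(A^T\Lambda^{-1}A-M)\begin{pmatrix}\vec{y}_1\\ \vdots\\ \vec{y}_n\end{pmatrix}=0,\qquad (AM^{-1}A^T-\Lambda)\begin{pmatrix}\vec{x}_1\\ \vdots\\ \vec{x}_n\end{pmatrix}=0,$$ and the optimal value is $B(\vec{x},\vec{y})=\mathrm{tr}(\Lambda)=\mathrm{tr}(M)$.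
   Context: Here $\cdot$ is the standard inner product and $|\cdot|$ the Euclidean norm on $\mathbb{R}^d$. An optimal point is a point $(\vec{x},\vec{y})$ satisfying the constraints at which $B$ attains its maximum (or minimum) over all points satisfying the constraints. The column $\begin{pmatrix}\vec{y}_1\\ \vdots\\ \vec{y}_n\end{pmatrix}$ denotes the $n\times d$ real matrix whose $k$-th row is $\vec{y}_k=(y_{k1},\dots,y_{kd})$, and similarly for $\vec{x}$; thus the equations say that for every $1\le r\le d$ the vectors $(y_{1r},\dots,y_{nr})^T$ and $(x_{1r},\dots,x_{nr})^T$ are annihilated by $A^T\Lambda^{-1}A-M$ and $AM^{-1}A^T-\Lambda$ respectively. *)

(* Defs.v *)
From mathcomp Require Import all_boot all_order all_algebra.
From mathcomp Require Import reals.

Set Implicit Arguments.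
Unset Strict Implicit.
Unset Printing Implicit Defensive.

Import Order.TTheory GRing.Theory Num.Theory.
Local Open Scope ring_scope.

(* The library's dotmx is restricted to numClosedFieldType, and the norm that
   MathComp-Analysis puts on matrices is the sup norm, hence these two. *)
Definition dot (R : realType) (d : nat) (u v : 'rV[R]_d) : R :=
  \sum_(r < d) u 0 r * v 0 r.

Definition enorm (R : realType) (d : nat) (u : 'rV[R]_d) : R :=
  Num.sqrt (dot u u).

Definition bilin (R : realType) (n d : nat) (A : 'M[R]_n)
    (x y : 'I_n -> 'rV[R]_d) : R :=
  \sum_(k < n) \sum_(j < n) A k j * dot (x k) (y j).

Definition feasible (R : realType) (n d : nat) (x y : 'I_n -> 'rV[R]_d) : Prop :=
  forall k : 'I_n, enorm (x k) = 1 /\ enorm (y k) = 1.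

Definition optimal (R : realType) (n d : nat) (A : 'M[R]_n)
    (x y : 'I_n -> 'rV[R]_d) : Prop :=
  feasible x y /\
  ((forall x' y' : 'I_n -> 'rV[R]_d, feasible x' y' ->
      bilin A x' y' <= bilin A x y) \/
   (forall x' y' : 'I_n -> 'rV[R]_d, feasible x' y' ->
      bilin A x y <= bilin A x' y')).

(* Main.v *)
Require Import Defs.
From mathcomp Require Import all_boot all_order all_algebra.
From mathcomp Require Import reals.

(** Fix [y] and all the [x_j] with [j != k]: then [B] depends on [x_k] only
    through [x_k . v_k], with [v_k = \sum_j a_kj y_j].  By Cauchy-Schwarz, an
    optimal unit vector [x_k] is collinear to [v_k], that is
    [v_k = lambda_k x_k].  In matrix form [A Y = Lambda X] and, exchanging the
    roles of [x] and [y], [A^T X = M Y]; eliminating [X] or [Y] gives the two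
    equations. *)

Import Order.TTheory GRing.Theory Num.Theory.

Local Open Scope ring_scope.

Section DotProduct.
Context {R : realType} {d : nat}.
Implicit Types (u v w : 'rV[R]_d) (a : R).

Lemma dotC u v : dot u v = dot v u.
Proof. by apply: eq_bigr => r _; rewrite mulrC. Qed.

Lemma dotZl a u v : dot (a *: u) v = a * dot u v.
Proof. by rewrite /dot mulr_sumr; apply: eq_bigr => r _; rewrite mxE mulrA. Qed.

Lemma dotBl u v w : dot (u - v) w = dot u w - dot v w.
Proof.
by rewrite /dot -sumrB; apply: eq_bigr => r _; rewrite !mxE mulrBl.
Qed.

Lemma dot_ge0 u : 0 <= dot u u.
Proof. by apply: sumr_ge0 => r _; rewrite -expr2 sqr_ge0. Qed.

Lemma dot_eq0 u : (dot u u == 0) = (u == 0).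
Proof.
apply/idP/eqP => [|->]; last first.
  by rewrite /dot big1 // => r _; rewrite mxE mul0r.
rewrite psumr_eq0 => [/allP h|r _]; last by rewrite -expr2 sqr_ge0.
apply/rowP => r; rewrite mxE; apply/eqP.
by have := h r (mem_index_enum r); rewrite mulf_eq0 orbb.
Qed.

Lemma enorm_eq1 u : (enorm u = 1) <-> (dot u u = 1).
Proof.
rewrite /enorm; split=> [h|->]; last exact: sqrtr1.
by rewrite -(sqr_sqrtr (dot_ge0 u)) h expr1n.
Qed.

(** Comparing [u] with the normalized vector [v / |v|] yields [|v| <= u . v]. Since [u] is a unit
    vector, the residual [v - (u . v) u] has squared norm [|v|^2 - (u . v)^2], which is then at most
    0, so the residual vanishes. *)
Lemma unit_maximizer_collinear u v : enorm u = 1 ->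
  (forall w, enorm w = 1 -> dot w v <= dot u v) -> v = dot u v *: u.
Proof.
move=> /enorm_eq1 u1 umax.
(* The zero vector cannot be normalized; there both sides are 0. *)
have [-> | v_neq0] := eqVneq v 0.
  by rewrite dotC (_ : dot 0 u = 0) ?scale0r // -(scale0r u) dotZl mul0r.
have vv_gt0 : 0 < dot v v by rewrite lt_def dot_eq0 v_neq0 dot_ge0.
have nv_gt0 : 0 < enorm v by rewrite sqrtr_gt0.
have vvE : dot v v = enorm v ^+ 2 by rewrite sqr_sqrtr ?dot_ge0.
have vvK : enorm v \is a GRing.unit by rewrite unitfE gt_eqF.
have le_uv : enorm v <= dot u v.
  have /umax : enorm ((enorm v)^-1 *: v) = 1.
    by apply/enorm_eq1; rewrite dotZl dotC dotZl vvE expr2 mulKr ?mulVr.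
  by rewrite dotZl vvE expr2 mulKr.
apply/eqP; rewrite -subr_eq0 -dot_eq0 eq_le dot_ge0 andbT.
have -> : dot (v - dot u v *: u) (v - dot u v *: u) = dot v v - dot u v ^+ 2.
  rewrite dotBl dotZl ![dot _ (v - _)]dotC !dotBl !dotZl u1 (dotC v u) mulr1.
  by rewrite subrr mulr0 subr0 expr2.
by rewrite subr_le0 vvE lerXn2r // nnegrE ltW // (lt_le_trans nv_gt0).
Qed.

End DotProduct.

Section Optimality.
Context {R : realType} {n d : nat}.
Implicit Types (A : 'M[R]_n) (x y : 'I_n -> 'rV[R]_d).

Lemma dot_row_mulmx A y (u : 'rV[R]_d) k :
  dot u (row k (A *m \matrix_(j < n) y j)) = \sum_(j < n) A k j * dot u (y j).
Proof.
rewrite /dot; under [RHS]eq_bigr => j _ do rewrite mulr_sumr.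
rewrite exchange_big; apply: eq_bigr => r _; rewrite !mxE mulr_sumr.
by apply: eq_bigr => j _; rewrite mxE mulrCA.
Qed.

(** In this form each [x k] occurs in exactly one summand, so it can be varied alone. *)
Lemma bilin_row A x y :
  bilin A x y = \sum_(k < n) dot (x k) (row k (A *m \matrix_(j < n) y j)).
Proof. by apply: eq_bigr => k _; rewrite dot_row_mulmx. Qed.

Lemma bilin_tr A x y : bilin A^T y x = bilin A x y.
Proof.
rewrite /bilin exchange_big; apply: eq_bigr => k _; apply: eq_bigr => j _.
by rewrite mxE dotC.
Qed.

Lemma bilinN A x y : bilin (- A) x y = - bilin A x y.
Proof.
rewrite /bilin -sumrN; apply: eq_bigr => k _; rewrite -sumrN.
by apply: eq_bigr => j _; rewrite mxE mulNr.
Qed.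

(** This symmetry lets the relation for [A^T] and [mu] follow from the one for [A] and [lambda]. *)
Lemma optimal_tr A x y : optimal A x y -> optimal A^T y x.
Proof.
have swap x' y' : feasible x' y' -> feasible y' x'.
  by move=> h k; have [] := h k.
move=> [/swap fxy [] h]; split=> //; [left | right] => x' y' /swap/h;
  by rewrite !bilin_tr.
Qed.

Lemma maximal_row A x y : feasible x y ->
    (forall x' y', feasible x' y' -> bilin A x' y' <= bilin A x y) ->
  forall k, row k (A *m \matrix_(j < n) y j)
            = (\sum_(j < n) A k j * dot (x k) (y j)) *: x k.
Proof.
move=> fxy hmax k; rewrite -dot_row_mulmx; apply: unit_maximizer_collinear.
  by have [] := fxy k.
(* The competitor replaces only [x k] by [w]: it stays feasible, and the summands with [j != k]
   cancel from the comparison of the two values of [bilin]. *)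
move=> w w1; pose x' j := if j == k then w else x j.
have /hmax : feasible x' y.
  by move=> j; rewrite /x'; have [xj yj] := fxy j; case: ifP.
rewrite !bilin_row (bigD1 k) //= [leRHS](bigD1 k) //= {1}/x' eqxx.
rewrite (eq_bigr (fun j => dot (x j) (row j (A *m \matrix_(i < n) y i)))).
  by rewrite lerD2r.
by move=> j /negPf jk; rewrite /x' jk.
Qed.

Lemma optimal_stationary A x y (lambda : 'rV[R]_n) : optimal A x y ->
    (forall k, lambda 0 k = \sum_(j < n) A k j * dot (x k) (y j)) ->
  A *m (\matrix_(k < n) y k) = diag_mx lambda *m (\matrix_(k < n) x k).
Proof.
move=> [fxy hopt] hlambda; apply/row_matrixP => k.
have -> : row k (diag_mx lambda *m \matrix_(k < n) x k) = lambda 0 k *: x k.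
  by apply/rowP => r; rewrite mul_diag_mx !mxE.
rewrite hlambda.
case: hopt => h; first exact: maximal_row.
(* A minimizer for [A] is a maximizer for [- A], and both sides of the row identity are odd in
   [A]. *)
have hN : forall x' y', feasible x' y' -> bilin (- A) x' y' <= bilin (- A) x y.
  by move=> x' y' /h; rewrite !bilinN lerN2.
apply: oppr_inj; have := maximal_row (- A) x y fxy hN k.
rewrite mulNmx linearN /= => ->; rewrite -scaleNr -sumrN.
by congr (_ *: _); apply: eq_bigr => j _; rewrite mxE mulNr.
Qed.

Lemma unitmx_diag (v : 'rV[R]_n) : (forall k, v 0 k <> 0) -> diag_mx v \in unitmx.
Proof.
move=> v0; rewrite unitmxE det_diag unitfE; apply/prodf_neq0 => k _.
exact/eqP/v0.
Qed.

Lemma bilin_trace A x y (lambda : 'rV[R]_n) :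
    (forall k, lambda 0 k = \sum_(j < n) A k j * dot (x k) (y j)) ->
  bilin A x y = \tr (diag_mx lambda).
Proof. by move=> h; rewrite mxtrace_diag; apply: eq_bigr => k _; rewrite h. Qed.

End Optimality.

Theorem proposition2p1 (R : realType) (n d : nat) (hn : (1 <= n)%N) (hd : (1 <= d)%N)
  (A : 'M[R]_n) (x y : 'I_n -> 'rV[R]_d) (hopt : optimal A x y)
  (lambda mu : 'rV[R]_n)
  (hlambda : forall k : 'I_n, lambda 0 k = \sum_(j < n) A k j * dot (x k) (y j))
  (hmu : forall k : 'I_n, mu 0 k = \sum_(j < n) A j k * dot (x j) (y k))
  (hlambda0 : forall k : 'I_n, lambda 0 k <> 0)
  (hmu0 : forall k : 'I_n, mu 0 k <> 0) :
  let Lambda : 'M[R]_n := diag_mx lambda in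
  let M : 'M[R]_n := diag_mx mu in
  [/\ (A^T *m invmx Lambda *m A - M) *m (\matrix_(k < n) y k) = 0,
      (A *m invmx M *m A^T - Lambda) *m (\matrix_(k < n) x k) = 0,
      bilin A x y = \tr Lambda
    & \tr Lambda = \tr M].
Proof.
move=> Lambda M.
(* The [mu] are the row multipliers of the transposed problem, with [y] in the first slot. *)
have hmuT k : mu 0 k = \sum_(j < n) A^T k j * dot (y k) (x j).
  by rewrite hmu; apply: eq_bigr => j _; rewrite mxE dotC.
have AY := optimal_stationary A x y lambda hopt hlambda.
have AX := optimal_stationary A^T y x mu (optimal_tr A x y hopt) hmuT.
have trL := bilin_trace A x y lambda hlambda.
split=> //; last by rewrite -trL -(bilin_trace A^T y x mu hmuT) bilin_tr.
  (* With [X], [Y] the matrices of rows [x k], [y k]: [A^T Lambda^-1 (A Y) = A^T Lambda^-1 Lambda X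
     = A^T X = M Y]. *)
  by rewrite mulmxBl -!mulmxA AY mulKmx ?unitmx_diag // AX subrr.
by rewrite mulmxBl -!mulmxA AX mulKmx ?unitmx_diag // AY subrr.
Qed.
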